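(* Let $G$ be a finite group, let $d > 1$ be the degree of a complex irreducible character of $G$, and write $|G| = d(d+e)$ where $e > 1$ is an integer. Then $|G| = e^4 - e^3$ if and only if $G$ has a Gagola character of degree $d$ and a unique minimal normal subgroup $N$, with $|N| = e$.
   Context: A complex irreducible character $\chi$ of a finite group $G$ is called a Gagola character if $\chi$ vanishes on all but two conjugacy classes of $G$. *)

(* Defs.v *)
From HB Require Import structures.
From mathcomp Require Import all_boot all_order all_algebra all_fingroup all_solvable all_field all_character.
Set Implicit Arguments. Unset Strict Implicit. Unset Printing Implicit Defensive.
Import GRing.Theory Num.Theory.
Local Open Scope ring_scope.

Definition gagola (gT : finGroupType) (G : {group gT}) (chi : 'CF(G)) : Prop :=
  chi \in irr G /\
  #|[set xG in classes G | [exists x in xG, chi x != 0]]| = 2%N.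

Definition min_normal_sub (gT : finGroupType) (N G : {group gT}) : Prop :=
  (N \subset G) && minnormal N G.

(* Main.v *)
(* Write N for the intersection of the kernels of all irreducible characters
   other than chi = chi_i.  Column orthogonality shows that, if N <> 1, then N^#
   is a single class, chi vanishes off N, and N lies in every nontrivial normal
   subgroup.  A Gagola character has N <> 1, and if |N| = e, comparing |x^G| = e-1
   with |C(x)| = d e + e^2 for x in N^# yields d = e (e-1).

   Conversely |G| = e^4 - e^3 forces d = e (e-1), and the squares of the other
   degrees sum to e^3 - e^2.  If e is a power of p, a central x <> 1 of a Sylow
   p-subgroup satisfies |C(x)| >= e^3; this makes the column orthogonality
   estimates at x equalities, so x lies in N.  If e is not a prime power, let q
   be a full prime-power factor of e, for a prime p, with q < m = e / q.  Here
   chi is integer valued, being the only irreducible character of its degree,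
   and a Frobenius-type congruence shows that the sum of chi^2 over the
   p-singular elements is divisible by d m^2; it is at most d e < d m^2, so it
   is 0, and chi vanishes on p-singular elements, contradicting |G|_p = q^3. *)
Require Import Defs.
From HB Require Import structures.
From mathcomp Require Import all_boot all_order all_algebra all_fingroup all_solvable all_field all_character.
From mathcomp Require Import zify ring.
Import GRing.Theory Num.Theory.
Local Open Scope ring_scope.

(** * The isolator of an irreducible character *)

Definition isolator {gT : finGroupType} {G : {group gT}} (i : Iirr G) :
  {group gT} := (\bigcap_(j | j != i) cfker 'chi_j)%G.

Lemma isolatorP {gT : finGroupType} {G : {group gT}} {i : Iirr G} {x : gT} :
  reflect (forall j, j != i -> 'chi_j x = 'chi_j 1%g) (x \in isolator i).
Proof.
apply: (iffP bigcapP) => [Nx j /Nx | Nx j /Nx].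
  by rewrite /= cfkerEirr inE => /eqP.
by move/eqP; rewrite /= cfkerEirr inE.
Qed.

Lemma irr1_conj {gT : finGroupType} {G : {group gT}} (j : Iirr G) :
  ('chi_j 1%g)^* = 'chi_j 1%g.
Proof. by rewrite conj_natr ?Cnat_irr1. Qed.

Lemma sum_irr1_sqr_neq {gT : finGroupType} {G : {group gT}} (i : Iirr G) :
  \sum_(j | j != i) 'chi_j 1%g ^+ 2 = #|G|%:R - 'chi_i 1%g ^+ 2.
Proof. by rewrite -irr_sum_square [in RHS](bigD1 i) //= addrAC subrr add0r. Qed.

Lemma sum_irr1_mul_neq {gT : finGroupType} {G : {group gT}} (i : Iirr G)
  (x : gT) :
  x != 1%g ->
  \sum_(j | j != i) 'chi_j x * 'chi_j 1%g = - ('chi_i x * 'chi_i 1%g).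
Proof.
move=> ntx; apply/eqP; rewrite -addr_eq0 addrC; apply/eqP.
have := second_orthogonality_relation x (group1 G).
rewrite class1G inE (negPf ntx) mulr0n [in LHS](bigD1 i) //= irr1_conj.
move=> Dx; rewrite -[RHS]Dx; congr (_ + _).
by apply: eq_bigr => j _; rewrite irr1_conj.
Qed.

Section Isolator.

Set Implicit Arguments.
Unset Strict Implicit.

Local Open Scope group_scope.
Local Open Scope ring_scope.

Context {gT : finGroupType} {G : {group gT}} {i : Iirr G}.
Hypothesis nz_i : i != 0.
Hypothesis nsq : 'chi_i 1%g ^+ 2 != #|G|%:R.
Local Notation N := (isolator i).

Lemma isolator_normal : N <| G.
Proof.
rewrite /normal; apply/andP; split.
  (* As [i != 0], the trivial character takes part in the intersection, which is thus not the empty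
     one, equal to all of [gT]. *)
  apply: (bigcap_min 0); first by rewrite eq_sym.
  exact: cfker_sub.
by apply/norms_bigcap/bigcapsP => j _; have /andP[] := cfker_normal 'chi_j.
Qed.

(** On N the other characters equal their degrees, so column orthogonality with 1 turns into a sum
    of squared degrees. Hence chi_i is constant on N^#. *)
Lemma isolator_val x : x \in N -> x != 1%g ->
  'chi_i x * 'chi_i 1%g = 'chi_i 1%g ^+ 2 - #|G|%:R.
Proof.
move=> /isolatorP Nx /(sum_irr1_mul_neq i) Dx; apply: oppr_inj.
rewrite -Dx opprB -sum_irr1_sqr_neq; apply: eq_bigr => j ij.
by rewrite Nx.
Qed.

Lemma isolator_val_neq0 x : x \in N -> x != 1%g -> 'chi_i x != 0.
Proof.
move=> Nx ntx; apply: contraNneq nsq => x0.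
by have := isolator_val Nx ntx; rewrite x0 mul0r => /esym/eqP; rewrite subr_eq0.
Qed.

Lemma isolator_val_neq1 x : x \in N -> x != 1%g -> 'chi_i x != 'chi_i 1%g.
Proof.
move=> Nx ntx; apply/eqP => x1; have := isolator_val Nx ntx.
move/eqP; rewrite x1 -expr2 eq_sym addrC -subr_eq0 addrK oppr_eq0.
by rewrite pnatr_eq0 -leqn0 leqNgt cardG_gt0.
Qed.

(** Any two elements of N^# have the same column in the character table; if they were not conjugate,
    |C_G(x)| would be 0. *)
Lemma isolator_class x : x \in N -> x != 1%g -> x ^: G = N^#.
Proof.
move=> Nx ntx; have /andP[sNG nNG] := isolator_normal.
have Gx := subsetP sNG x Nx.
apply/eqP; rewrite eqEsubset; apply/andP; split.
  apply/subsetP=> _ /imsetP[y Gy ->].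
  by rewrite !inE conjg_eq1 ntx memJ_norm ?(subsetP nNG).
apply/subsetP=> y /setD1P[nty Ny].
have := second_orthogonality_relation y Gx.
case: (y \in x ^: G) => //; rewrite mulr0n => /eqP.
have -> : \sum_j 'chi[G]_j y * ('chi_j x)^* = \sum_j 'chi[G]_j x * ('chi_j x)^*.
  apply: eq_bigr => j _; congr (_ * _); have [-> | ij] := eqVneq j i.
    apply: (mulIf (irr1_neq0 i)); by rewrite !isolator_val.
  by rewrite (isolatorP Ny) // (isolatorP Nx).
rewrite second_orthogonality_relation // class_refl mulr1n pnatr_eq0.
by rewrite -leqn0 leqNgt cardG_gt0.
Qed.

(** Away from i, the columns of 1 and of x in N^# agree. Subtracting their orthogonality relations
    with g leaves chi_i(g) times a nonzero factor. *)
Lemma isolator_vanish g : N :!=: 1%g -> g \notin N -> 'chi_i g = 0.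
Proof.
case/trivgPn=> x Nx ntx N'g.
have Gx : x \in G := subsetP (normal_sub isolator_normal) x Nx.
have ntg : g != 1%g by apply: contraNneq N'g => ->.
have := second_orthogonality_relation g Gx.
rewrite isolator_class // !inE (negPf N'g) andbF mulr0n.
rewrite (bigD1 i) //=.
under eq_bigr => j ij do rewrite (isolatorP Nx) // irr1_conj.
rewrite sum_irr1_mul_neq // -mulrBr => /eqP; rewrite mulf_eq0 => /orP[/eqP//|].
rewrite subr_eq0 -(irr1_conj i) (inj_eq (can_inj conjCK)).
by rewrite (negPf (isolator_val_neq1 Nx ntx)).
Qed.

Lemma isolator_gagola : N :!=: 1%g -> gagola 'chi_i.
Proof.
move=> ntN; split; first exact: mem_irr.
have [x Nx ntx] := trivgPn _ ntN.
have Gx : x \in G := subsetP (normal_sub isolator_normal) x Nx.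
suffices -> : [set xG in classes G | [exists y in xG, 'chi_i y != 0]]
   = [set 1%g ^: G; x ^: G].
  rewrite cards2 class1G isolator_class //; case: eqP => // /setP/(_ 1%g).
  by rewrite !inE eqxx.
apply/setP=> xG; rewrite !inE; apply/andP/orP.
  case=> /imsetP[y Gy ->{xG}] /exists_inP[_ /imsetP[z Gz ->]]; rewrite cfunJ //.
  move=> nzy; have [->|nty] := eqVneq y 1%g; first by left.
  right; rewrite (isolator_class Nx ntx) -(isolator_class _ nty) //.
  by apply: contraNT nzy => /(isolator_vanish ntN) ->.
by case=> /eqP ->; rewrite mem_classes //; split=> //; apply/exists_inP;
   [exists 1%g | exists x]; rewrite ?class_refl ?irr1_neq0 ?isolator_val_neq0.
Qed.

(** If M meets N nontrivially, it contains the class N^#. Otherwise chi_i vanishes on M^#, so its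
    restriction to M contains the trivial character; by Clifford M lies in the kernel of chi_i,
    which is absurd. *)
Lemma isolator_sub_normal (M : {group gT}) :
  N :!=: 1%g -> M <| G -> M :!=: 1%g -> N \subset M.
Proof.
move=> ntN nsMG /trivgPn[m Mm ntm]; have /andP[sMG nMG] := nsMG.
have [NM1 | /trivgPn[x /setIP[Nx Mx] ntx]] := eqVneq (N :&: M) 1%g; last first.
  rewrite -(setD1K (group1 N)) -(isolator_class Nx ntx) subUset sub1set group1.
  by rewrite class_sub_norm.
have vanM x : x \in M -> x != 1%g -> 'chi_i x = 0.
  move=> Mx ntx; apply: isolator_vanish => //.
  by apply: contra ntx => Nx; rewrite -in_set1 -[[set 1%g]]NM1 inE Nx.
have : M \subset cfker 'chi_i.
  apply: constt0_Res_cfker => //.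
  rewrite irr_consttE irr0 cfdotE mulf_neq0 ?invr_eq0 ?neq0CG //.
  rewrite (bigD1 1%g) //= big1 => [|x /andP[Mx ntx]]; last first.
    by rewrite cfResE // vanM ?mul0r.
  by rewrite addr0 cfResE // cfun11 conjC1 mulr1 irr1_neq0.
move/subsetP/(_ m Mm); rewrite cfkerEirr inE vanM //.
by rewrite eq_sym (negPf (irr1_neq0 i)).
Qed.

Lemma isolator_minnormal : N :!=: 1%g -> min_normal_sub N G.
Proof.
move=> ntN; have /andP[sNG nNG] := isolator_normal.
apply/andP; split=> //; apply/mingroupP; split; first by rewrite ntN.
move=> M /andP[ntM nMG] sMN; apply/eqP; rewrite eqEsubset sMN.
by rewrite isolator_sub_normal // /normal (subset_trans sMN).
Qed.

Lemma isolator_minnormal_unique (M : {group gT}) :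
  N :!=: 1%g -> min_normal_sub M G -> M = N.
Proof.
move=> ntN /andP[sMG /mingroupP[/andP[ntM nMG] minM]]; apply/val_inj.
have /andP[_ nNG] := isolator_normal.
apply/esym/minM; first by rewrite ntN.
by rewrite isolator_sub_normal // /normal sMG.
Qed.

End Isolator.

(** * Frobenius-type congruences for sums over unions of r-sections *)

Section PartSums.

Set Implicit Arguments.
Unset Strict Implicit.
Local Open Scope group_scope.
Local Open Scope ring_scope.

Context {gT : finGroupType}.
Implicit Types (G H C R : {group gT}) (r : nat).

Lemma cfInd1_fix H G u : H \subset G ->
  'Ind[G] (1 : 'CF(H)) u = #|'Fix_(rcosets H G | 'Rs)(<[u]>)|%:R.
Proof.
move=> sHG; rewrite cfIndE //.
(* After inversion the summand is constant on each right coset of H: it tells whether u fixes that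
   coset. *)
rewrite (reindex_inj invg_inj) /=.
rewrite (eq_bigl [in G]) => [|y]; last by rewrite groupV.
rewrite (set_partition_big _ (rcosets_partition sHG)) /= -[in RHS]sum1_card natr_sum.
rewrite big_mkcond [RHS]big_mkcond /= mulr_sumr; apply: eq_bigr => A _.
rewrite in_setI; case: ifP => // [HA|_]; last by rewrite mulr0.
rewrite (eq_bigr (fun=> (A \in 'Fix_('Rs)(<[u]>))%:R)) => [|y Ay].
  have /rcosetsP[y _ ->] := HA.
  rewrite sumr_const card_rcoset -[X in _ * X]mulr_natl mulKf ?neq0CG // /=.
  by case: (_ \in _).
have /rcosetsP[z _ DA] := HA.
rewrite cfun1E -mem_conjg -cycle_subG -sub_afixRs_norms.
by move: Ay; rewrite {1}DA => /rcoset_eqP ->; rewrite -DA.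
Qed.

(** A coset Rx fixed by u would put u in the r-group R^x. *)
Lemma cfInd1_Sylow_eq0 r G R u :
  r.-Sylow(G) R -> ~~ r.-elt u -> 'Ind[G] (1 : 'CF(R)) u = 0.
Proof.
move=> sylR r'u; rewrite cfInd1_fix ?(pHall_sub sylR) //; apply/eqP.
rewrite pnatr_eq0 cards_eq0; apply/set0Pn=> -[A /setIP[/rcosetsP[x _ ->]]].
rewrite sub_afixRs_norms cycle_subG => Ru; case/negP: r'u.
by rewrite (mem_p_elt _ Ru) // pgroupJ (pHall_pgroup sylR).
Qed.

(* By Euler's theorem, a suitable power of the permutation character on the
   cosets of a Sylow r-subgroup is the indicator of the r-elements mod r^k. *)
Lemma vchar_eqmod_p_elt r G k : prime r ->
  exists2 xi : 'CF(G), xi \in 'Z[irr G] &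
    {in G, forall u, (xi u == (r.-elt u)%:R %[mod (r ^ k)%:R])%A}.
Proof.
move=> r_pr; have [R sylR] := Sylow_exists r G.
exists ('Ind[G] (1 : 'CF(R)) ^+ totient (r ^ k)).
  by apply/char_vchar/rpredX/cfInd_char/rpred1.
move=> u Gu; have k_gt0 : (0 < totient (r ^ k))%N.
  by rewrite totient_gt0 expn_gt0 prime_gt0.
rewrite exp_cfunE //; have [r_u | r'u] := boolP (r.-elt u); last first.
  by rewrite (cfInd1_Sylow_eq0 sylR) // expr0n -(prednK k_gt0).
rewrite cfInd1_fix ?(pHall_sub sylR) // -natrX.
set n := #|_|.
(* The r-group generated by u fixes |G : R| points modulo r, and r does not divide |G : R|. *)
have co_n : coprime n (r ^ k).
  rewrite coprime_sym coprimeXl // prime_coprime // /dvdn.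
  have <- : #|rcosets R G| = n %[mod r].
    apply: pgroup_fix_mod => //.
    by apply: subset_trans (actsRs_rcosets R G); rewrite cycle_subG.
  by rewrite -[(_ %% _)%N == _]/(r %| #|G : R|)%N -p'natE //; case/and3P: sylR.
have : ((n ^ totient (r ^ k))%N == 1%N %[mod (r ^ k)%N])%C.
  by rewrite eqCmod_nat; apply/eqP/Euler_exp_totient.
rewrite /eqCmod /eqAmod !CdivE [(_ %| _)%C]unfold_in [(_ %| _)%A]unfold_in.
by case: ifP => // _ /Aint_Cint.
Qed.

Lemma dvdA_natl (m n : nat) (z : algC) :
  (m %| n)%N -> (0 < n)%N -> (n%:R %| z)%A -> (m%:R %| z)%A.
Proof.
case/dvdnP=> q ->; rewrite muln_gt0 => /andP[q0 m0].
rewrite ![(_ %| _)%A]unfold_in !pnatr_eq0.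
rewrite !gtn_eqF ?muln_gt0 ?q0 //.
set w := z / _ => Zw; suffices -> : z / m%:R = w * q%:R by rewrite rpredM ?rpred_nat.
by rewrite /w natrM invfM mulrA mulrAC divfK ?mulrA // pnatr_eq0 -lt0n.
Qed.

(** Expand both factors in irreducible characters. Generalized orthogonality leaves |G| times
    integral combinations of chi_j(y) / chi_j(1), an algebraic integer since the class of y is a
    singleton. *)
Lemma vchar_sum_central G y (theta xi : 'CF(G)) : y \in 'Z(G) ->
  theta \in 'Z[irr G] -> xi \in 'Z[irr G] ->
  (#|G|%:R %| \sum_(u in G) theta (y * u)%g * xi u)%A.
Proof.
case/setIP=> Gy cGy Ztheta Zxi.
rewrite [(_ %| _)%A]unfold_in pnatr_eq0 -leqn0 leqNgt cardG_gt0 /=.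
rewrite mulrC [theta]cfun_sum_cfdot [xi]cfun_sum_cfdot.
suffices -> : #|G|%:R^-1 * (\sum_(u in G)
     (\sum_j '[theta, 'chi_j] *: 'chi_j) (y * u)%g *
     (\sum_k '[xi, 'chi_k] *: 'chi_k) u)
  = \sum_j \sum_k '[theta, 'chi_j] * '[xi, 'chi_k] *
       ((j == conjC_Iirr k)%:R * ('chi[G]_j y / 'chi_j 1%g)).
  apply: rpred_sum => j _; apply: rpred_sum => k _.
  have Zcoef phi l : phi \in 'Z[irr G] -> '[phi, 'chi_l] \in Aint.
    by move=> Zphi; apply/Aint_Cint/Cint_cfdot_vchar_irr.
  apply: rpredM; first exact: rpredM (Zcoef _ _ Ztheta) (Zcoef _ _ Zxi).
  apply: rpredM; first exact: rpred_nat.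
  have := Aint_class_div_irr1 j Gy.
  by rewrite -index_cent1 (setIidPl _) ?sub_cent1 // indexgg mul1r.
under eq_bigr => u Gu do rewrite !sum_cfunE big_distrlr /=.
rewrite exchange_big mulr_sumr /=; apply: eq_bigr => j _.
rewrite exchange_big mulr_sumr /=; apply: eq_bigr => k _.
rewrite -generalized_orthogonality_relation [RHS]mulrCA; congr (_ * _).
rewrite mulr_sumr; apply: eq_bigr => u Gu; rewrite !cfunE mulrACA.
rewrite conjC_IirrE cfunE irr_inv (centP cGy) //.
by congr (_ * (_ * _)); rewrite /= conjCK.
Qed.

(** Modulo |G|_r the indicator of the r-elements can be replaced by a virtual character, and then
    the sum is divisible even by |G|. *)
Lemma p_elt_sum_central r G y (theta : 'CF(G)) : prime r -> y \in 'Z(G) ->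
  theta \in 'Z[irr G] ->
  ((#|G|`_r)%N%:R %| \sum_(u in G | r.-elt u) theta (y * u)%g)%A.
Proof.
move=> r_pr Zy Ztheta; have [xi Zxi Dxi] := vchar_eqmod_p_elt G (logn r #|G|) r_pr.
rewrite big_mkcondr /= -eqAmod0.
have := dvdA_natl (dvdn_part r #|G|) (cardG_gt0 G) (vchar_sum_central Zy Ztheta Zxi).
rewrite -eqAmod0; apply: eqAmod_trans; rewrite /eqAmod -sumrB.
apply: rpred_sum => u Gu.
have -> : (if r.-elt u then theta (y * u)%g else 0) = theta (y * u)%g * (r.-elt u)%:R.
  by case: ifP; rewrite ?mulr1 ?mulr0.
rewrite -/(eqAmod _ _ _) p_part eqAmodMl ?(Aint_vchar _ Ztheta) //.
by rewrite eqAmod_sym Dxi.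
Qed.

Lemma p_elt_sum_cent1 r G y (theta : 'CF(G)) : prime r -> y \in G ->
  theta \in 'Z[irr G] ->
  ((#|'C_G[y]|`_r)%N%:R %| \sum_(u in 'C_G[y] | r.-elt u) theta (y * u)%g)%A.
Proof.
move=> r_pr Gy Ztheta.
have Zy : y \in 'Z('C_G[y]).
  rewrite inE inE Gy cent1id /=; apply/centP=> u /setIP[_ /cent1P cyu].
  exact: commute_sym.
suffices -> : \sum_(u in 'C_G[y] | r.-elt u) theta (y * u)%g
    = \sum_(u in 'C_G[y] | r.-elt u) 'Res['C_G[y]] theta (y * u)%g.
  exact: p_elt_sum_central r_pr Zy (cfRes_vchar _ Ztheta).
apply: eq_bigr => u /andP[cu _].
by rewrite cfResE ?subsetIl // groupM //; case/setIP: Zy.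
Qed.

Lemma dvdA_natM (k m : nat) (z : algC) :
  (m%:R %| z)%A -> ((k * m)%N%:R %| k%:R * z)%A.
Proof.
have [-> _ | nz_k] := eqVneq k 0%N; first by rewrite mul0r rpred0.
rewrite ![(_ %| _)%A]unfold_in !pnatr_eq0 muln_eq0 mulf_eq0 pnatr_eq0.
rewrite (negPf nz_k) /=; case: ifP => // _.
by rewrite natrM invfM mulrACA divff ?mul1r // pnatr_eq0.
Qed.

(* A sum over a union of r-sections: g = y u with y = g_{r'} fixed and u running
   over the r-elements of C(y), then y running over a conjugacy class. *)
Lemma section_sum_dvd r G (B : pred gT) (theta : 'CF(G)) : prime r ->
    {in G &, forall g h, B (g ^ h)%g = B g} ->
    (forall g, B g.`_r^'%g = B g) -> theta \in 'Z[irr G] ->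
  ((#|G|`_r)%N%:R %| \sum_(g in G | B g) theta g)%A.
Proof.
move=> r_pr BJ Br Ztheta.
pose W y := if r^'.-elt y && B y then
  \sum_(u in 'C_G[y] | r.-elt u) theta (y * u)%g else 0.
have WJ : {in G &, forall y h, W (y ^ h)%g = W y}.
  move=> y h Gy Gh; rewrite /W p_eltJ BJ //; case: ifP => // _.
  rewrite (reindex_inj (conjg_inj h)); apply: eq_big => u.
    by rewrite p_eltJ -{1}(conjGid Gh) cent1J -conjIg memJ_conjg.
  by move=> _; rewrite -conjMg cfunJ.
suffices -> : \sum_(g in G | B g) theta g = \sum_(y in G) W y.
  rewrite (sum_by_classes WJ); apply: rpred_sum => xG /repr_classesP[].
  move: (repr xG) => y Gy ->; rewrite /W; case: ifP => _; last by rewrite mulr0 rpred0.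
  (* |G|_r is the product of the r-parts of |y^G| and |C_G(y)|, so it divides |y^G| |C_G(y)|_r. *)
  have := dvdA_natM #|y ^: G| (p_elt_sum_cent1 r_pr Gy Ztheta).
  apply: dvdA_natl; last by rewrite muln_gt0 part_gt0 -index_cent1 indexg_gt0.
  rewrite -index_cent1 -(Lagrange (subsetIl G 'C[y])) partnM ?cardG_gt0 ?indexg_gt0 //.
  by rewrite mulnC dvdn_mul ?dvdn_part.
rewrite (partition_big (fun g => g.`_r^'%g) (fun y => [&& y \in G, r^'.-elt y & B y])).
  rewrite big_mkcondr /=; apply: eq_bigr => y Gy; rewrite /W.
  case: ifP => // /andP[r'y By].
  rewrite (reindex_onto (fun u => y * u)%g (fun g => y^-1 * g)%g) => [|g _]; last first.
    by rewrite mulKVg.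
  apply: eq_bigl => u; rewrite mulKg eqxx andbT.
  apply/andP/andP=> [[/andP[Gyu _] /eqP Dy] | [/setIP[Gu /cent1P cyu] r_u]].
    have Du : u = (y * u).`_r%g.
      by have := consttC r^' (y * u); rewrite consttNK Dy => /mulgI.
    split; last by rewrite Du p_elt_constt.
    rewrite inE -(groupMl _ Gy) Gyu; apply/cent1P.
    have := centsP (cycle_abelian (y * u)) _ (cycle_constt r^' _) _ (cycle_constt r _).
    by rewrite Dy -Du => /commute_sym.
  have Dy : (y * u).`_r^'%g = y.
    rewrite consttM; last exact: commute_sym.
    rewrite constt_p_elt // (constt1P _) ?mulg1 //.
    by rewrite /p_elt (eq_pnat _ (negnK r)).
  by rewrite groupM // Dy -Br Dy.
by move=> g /andP[Gg Bg]; rewrite p_elt_constt Br Bg groupX.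
Qed.

End PartSums.

(** * Rational characters and sums over p-singular elements *)

Section LargeDegree.

Import Order.TTheory.

Set Implicit Arguments.
Unset Strict Implicit.
Local Open Scope group_scope.
Local Open Scope ring_scope.

Context {gT : finGroupType} {G : {group gT}}.

(* A character with no other irreducible character of the same degree is fixed
   by all Galois automorphisms. *)
Lemma Cint_irr_unique_degree (i : Iirr G) x :
  (forall j : Iirr G, 'chi_j 1%g = 'chi_i 1%g -> j = i) ->
  'chi_i x \in Num.int.
Proof.
move=> uniq_i; have [Gx | /cfun0->] := boolP (x \in G); last by rewrite rpred0.
apply: Cint_rat_Aint; last exact: Aint_irr.
have [Qn galQn [QnC gQnC [_ _ Qn_g]]] := group_num_field_exists <[x]>.
have [a Da] := Qn_g _ G _ (irr_char i) x (dvdnn _).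
suffices: a \in fixedField 'Gal({:Qn} / 1).
  rewrite (galois_fixedField galQn) => /vlineP[c Dc].
  by rewrite -Da Dc alg_num_field fmorph_rat Crat_rat.
apply/fixedFieldP; first exact: memvf.
(* [s] extends to an automorphism [nu] of the algebraic numbers, which sends chi_i to an irreducible
   character of the same degree, that is, to itself. *)
move=> s _; have [nu Dnu] := gQnC s.
apply: (fmorph_inj QnC); rewrite Dnu Da.
have Di : aut_Iirr nu i = i.
  by apply: uniq_i; have /natrP[n Dn] := Cnat_irr1 i; rewrite aut_IirrE cfunE Dn rmorph_nat.
by rewrite -[in RHS]Di aut_IirrE cfunE.
Qed.

(** d / |P| is the multiplicity of the trivial character in the restriction to P. *)
Lemma irr_vanish_Sylow_dvd p (P : {group gT}) (i : Iirr G) (d : nat) :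
    p.-Sylow(G) P -> 'chi_i 1%g = d%:R ->
  {in P^#, forall x, 'chi_i x = 0} -> (#|P| %| d)%N.
Proof.
move=> sylP Dd van; have sPG := pHall_sub sylP.
rewrite -dvdC_nat unfold_in pnatr_eq0 gtn_eqF ?cardG_gt0 //.
suffices -> : d%:R / #|P|%:R = '['Res[P] 'chi_i, 'chi_0].
  by apply: Cint_cfdot_vchar_irr; apply: cfRes_vchar; apply: irr_vchar.
rewrite cfdotE (bigD1 1%g) //= big1 => [|x /andP[Px ntx]].
  by rewrite addr0 cfResE // Dd irr0 cfun11 conjC1 mulr1 mulrC.
by rewrite cfResE // van ?mul0r // !inE ntx.
Qed.

Lemma sum_irr_sqr_int (i : Iirr G) : (forall x, 'chi_i x \in Num.int) ->
  \sum_(x in G) 'chi_i x ^+ 2 = #|G|%:R.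
Proof.
move=> Zchi; have := cfdot_irr i i; rewrite eqxx cfdotE.
move=> /(canRL (mulVKf (neq0CG G))); rewrite mulr1 => <-.
by apply: eq_bigr => x Gx; rewrite conj_intr.
Qed.

(* Integrality of the central character gives the divisibility by d, and the
   r-parts for the primes r <> p give the divisibility by m. *)
Lemma p_singular_sqr_sum_dvd p (i : Iirr G) (d m : nat) :
    prime p -> (forall x, 'chi_i x \in Num.int) -> 'chi_i 1%g = d%:R ->
    (p^'.-nat m) -> (m %| #|G|)%N ->
  exists2 u : nat, \sum_(g in G | (p %| #[g])%N) 'chi_i g ^+ 2 = u%:R &
    (d %| u)%N && (m %| u)%N.
Proof.
move=> p_pr Zchi Dd p'm dvd_m_G.
set U := \sum_(g in G | _) _.
have /natrP[u Du] : U \in Num.nat.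
  by apply: rpred_sum => g _; rewrite -intr_normK ?rpredX ?natr_norm_int.
exists u => //.
have dvdA_nat k : (0 < k)%N -> (k%:R %| U)%A -> (k %| u)%N.
  move=> k_gt0; rewrite -dvdC_nat [(_ %| _)%A]unfold_in [(_ %| _)%C]unfold_in.
  rewrite pnatr_eq0 gtn_eqF //.
  by rewrite Du => Zq; apply: Cint_rat_Aint => //; rewrite rpred_div ?rpred_nat.
have d_gt0 : (0 < d)%N by rewrite -(ltr_nat algC) -Dd irr1_gt0.
apply/andP; split.
  apply: dvdA_nat => //; rewrite /U big_mkcondr /=.
  rewrite sum_by_classes => [|x y Gx Gy]; last by rewrite orderJ cfunJ.
  apply: rpred_sum => xG /repr_classesP[].
  move: (repr xG) => y Gy ->; case: ifP => _; last by rewrite mulr0 rpred0.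
  rewrite [(_ %| _)%A]unfold_in pnatr_eq0 gtn_eqF // -Dd expr2 mulrA mulrAC.
  by rewrite rpredM ?Aint_class_div_irr1 ?Aint_irr.
have m_gt0 : (0 < m)%N by apply: dvdn_gt0 dvd_m_G.
apply/dvdn_partP=> // r; rewrite mem_primes => /and3P[r_pr _ r_m].
have neq_pr : p != r by apply: contraTneq p'm => ->; rewrite p'natE // r_m.
apply: dvdn_trans (partn_dvd r (cardG_gt0 G) dvd_m_G) _.
apply: dvdA_nat; first exact: part_gt0.
have := @section_sum_dvd gT r G (fun g => (p %| #[g])%N) ('chi_i ^+ 2) r_pr.
have -> : U = \sum_(g in G | (p %| #[g])%N) ('chi_i ^+ 2) g.
  by apply: eq_bigr => g _; rewrite !expr2 cfunE.
apply; first by move=> g h _ _; rewrite orderJ.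
  (* As r differs from p, whether p divides the order of g depends only on the r'-part of g. *)
  move=> g; rewrite order_constt -{2}(partnC r (order_gt0 g)) Euclid_dvdM //.
  by rewrite p_part [(p %| r ^ _)%N]Euclid_dvdX // (dvdn_prime2 p_pr r_pr) (negPf neq_pr).
by apply: rpredX; apply: irr_vchar.
Qed.

(** * Groups of order e^4 - e^3 *)

Section Extremal.

Variables (i : Iirr G) (e : nat).
Hypotheses (e_gt1 : (1 < e)%N) (Dchi : 'chi_i 1%g = (e * e.-1)%:R).
Hypothesis DG : #|G| = (e ^ 3 * e.-1)%N.

Let e_gt0 : (0 < e)%N. Proof. exact: ltnW. Qed.
Let e1_gt0 : (0 < e.-1)%N. Proof. by rewrite -subn1 subn_gt0. Qed.

Lemma extremal_rest : \sum_(j | j != i) 'chi_j 1%g ^+ 2 = (e ^ 2 * e.-1)%:R :> algC.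
Proof.
rewrite sum_irr1_sqr_neq Dchi DG -natrX; apply/eqP; rewrite subr_eq -natrD eqr_nat.
rewrite expnMn -[(e.-1 ^ 2)%N]mulnn mulnA -mulnS prednK //.
by rewrite mulnAC -expnSr.
Qed.

(** A second character of this degree would add e^2 (e-1)^2 to a sum equal to e^2 (e-1), impossible
    for e > 2. *)
Lemma extremal_unique_degree (j : Iirr G) : (2 < e)%N ->
  'chi_j 1%g = 'chi_i 1%g -> j = i.
Proof.
move=> e_gt2 Dj; apply/eqP/contraT=> ij.
have : 'chi_j 1%g ^+ 2 <= (e ^ 2 * e.-1)%:R.
  rewrite -extremal_rest (bigD1 j) //= lerDl sumr_ge0 // => k _.
  by rewrite exprn_ge0 ?char1_ge0 ?irr_char.
rewrite Dj Dchi -natrX ler_nat expnMn leq_pmul2l ?expn_gt0 ?e_gt0 //.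
by rewrite -[leqRHS]muln1 -mulnn leq_pmul2l // -ltnS prednK // leqNgt e_gt2.
Qed.

(* Otherwise, with q = e_p and m = e_{p'}, the sum of chi_i^2 over the p-singular
   elements is a multiple of d m^2 but at most d e = d q m < d m^2, so chi_i
   vanishes on them; then |G|_p = q^3 divides d_p = q. *)
Lemma extremal_part p : prime p -> (p %| e)%N -> (e`_p^' <= e`_p)%N.
Proof.
move=> p_pr dvd_p_e; rewrite leqNgt; apply/negP.
set m := (e`_p^')%N; set q := (e`_p)%N => lt_q_m.
have De : e = (q * m)%N by rewrite /q /m partnC.
have q_gt1 : (1 < q)%N by rewrite /q p_part_gt1 mem_primes p_pr e_gt0.
have m_gt1 : (1 < m)%N := ltn_trans q_gt1 lt_q_m.
have co_q_m : coprime q m := coprime_partC p e e.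
have e_gt2 : (2 < e)%N by rewrite De (leq_trans _ (leq_mul q_gt1 m_gt1)).
have p'm3 : p^'.-nat (m ^ 3)%N by rewrite pnatX part_pnat.
have dvd_m3 : (m ^ 3 %| #|G|)%N by rewrite DG De expnMn -mulnA mulnCA dvdn_mulr.
have Zchi x : 'chi_i x \in Num.int.
  by apply: Cint_irr_unique_degree => j; apply: extremal_unique_degree.
have [u Du /andP[dvd_d_u dvd_m_u]] := p_singular_sqr_sum_dvd p_pr Zchi Dchi p'm3 dvd_m3.
(* The identity is not p-singular, so u is at most |G| - chi_i(1)^2. *)
have le_u : (u <= e ^ 2 * e.-1)%N.
  rewrite -(ler_nat algC) -extremal_rest sum_irr1_sqr_neq -(sum_irr_sqr_int Zchi) -Du.
  rewrite [X in _ <= X - _](bigD1 1%g) //= addrAC subrr add0r.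
  rewrite big_mkcondr [X in _ <= X]big_mkcondr /=; apply: ler_sum => x Gx.
  have sqr_ge0 : 0 <= 'chi_i x ^+ 2 by rewrite -intr_normK ?exprn_ge0.
  case: eqP => [->|_]; first by rewrite order1 dvdn1 gtn_eqF ?prime_gt1.
  by case: ifP.
have u0 : u = 0%N.
  apply/eqP/contraT; rewrite -lt0n => u_gt0.
  (* q (e-1) divides d and is coprime to m^3; their product is d m^2. *)
  have co : coprime (q * e.-1) (m ^ 3).
    rewrite coprimeMl !coprimeXr // coprime_sym.
    rewrite (coprime_dvdl (_ : m %| e)%N) ?coprimenP //.
    by rewrite De dvdn_mull.
  have : (q * e.-1 * m ^ 3 %| u)%N.
    rewrite Gauss_dvd // dvd_m_u andbT; apply: dvdn_trans dvd_d_u.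
    by rewrite De mulnAC dvdn_mulr.
  move/(dvdn_leq u_gt0)/leq_trans/(_ le_u).
  have -> : (e ^ 2 = q ^ 2 * m ^ 2)%N by rewrite De expnMn.
  rewrite leqNgt.
  case/negP; have -> : (q ^ 2 * m ^ 2 * e.-1 = q * e.-1 * m ^ 2 * q)%N.
    ring.
  rewrite [(m ^ 3)%N]expnSr mulnA ltn_pmul2l //.
  by rewrite !(muln_gt0, expn_gt0) e1_gt0 (ltnW q_gt1) (ltnW m_gt1).
have [P sylP] := Sylow_exists p G.
have van : {in P^#, forall x, 'chi_i x = 0}.
  move=> x /setD1P[ntx Px]; have Gx := subsetP (pHall_sub sylP) x Px.
  have p_x : (p %| #[x])%N.
    have := mem_p_elt (pHall_pgroup sylP) Px; rewrite /p_elt => /p_natP[k Dk].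
    rewrite Dk dvdn_exp // lt0n; apply: contraNneq ntx => k0.
    by rewrite -order_eq1 Dk k0.
  have := Du; rewrite u0 => /eqP; rewrite psumr_eq0 => [/allP/(_ x)|y _].
    by rewrite mem_index_enum Gx p_x sqrf_eq0 => /(_ isT)/eqP.
  by rewrite -intr_normK ?exprn_ge0.
have := irr_vanish_Sylow_dvd sylP Dchi van.
have dvd_q3_P : (q ^ 3 %| #|P|)%N.
  rewrite (card_Hall sylP) -(@part_pnat_id p (q ^ 3)%N) ?pnatX ?part_pnat //.
  by rewrite partn_dvd ?cardG_gt0 // DG De expnMn -mulnA dvdn_mulr.
move/(dvdn_trans dvd_q3_P).
have -> : (e * e.-1 = q * (m * e.-1))%N by rewrite mulnA -De.
(* Since q is coprime to m (e-1), q^3 would divide q. *)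
rewrite Gauss_dvdl; last first.
  rewrite coprimeXl // coprimeMr co_q_m (coprime_dvdl (_ : q %| e)%N) ?coprimenP //.
  by rewrite De dvdn_mulr.
by move/(dvdn_leq (ltnW q_gt1)); rewrite leqNgt -{1}[q]expn1 ltn_exp2l.
Qed.

(** For a prime r dividing e_{p'}, the chain e_p >= e_{p'} >= e_r >= e_{r'} >= e_p forces equality,
    but e_p and e_{p'} are coprime. *)
Lemma extremal_prime_power : exists2 p : nat, prime p & p.-nat e.
Proof.
have p_pr := pdiv_prime e_gt1; exists (pdiv e) => //; set p := pdiv e in p_pr *.
have dvd_p_e : (p %| e)%N := pdiv_dvd e.
have [m_le1 | m_gt1] := leqP (e`_p^')%N 1.
  by rewrite -pnatNK -partn_eq1 // eqn_leq m_le1 part_gt0.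
have r_pr := pdiv_prime m_gt1; set r := pdiv _ in r_pr.
have r_m : (r %| e`_p^')%N := pdiv_dvd _.
have neq_rp : r != p.
  by apply: contraTneq r_m => ->; rewrite -p'natE ?part_pnat.
have le_r := extremal_part r_pr (dvdn_trans r_m (dvdn_part _ _)).
have le_rm : (e`_r <= e`_p^')%N.
  suffices <- : ((e`_p^')`_r = e`_r)%N by rewrite dvdn_leq ?part_gt0 ?dvdn_part.
  by apply: partn_part => s; rewrite !inE => /eqP->.
have le_pr : (e`_p <= e`_r^')%N.
  suffices <- : ((e`_r^')`_p = e`_p)%N by rewrite dvdn_leq ?part_gt0 ?dvdn_part.
  by apply: partn_part => s; rewrite !inE => /eqP->; rewrite eq_sym.
have Dm : (e`_p = e`_p^')%N.
  apply/eqP; rewrite eqn_leq (extremal_part p_pr dvd_p_e).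
  by rewrite (leq_trans le_pr) // (leq_trans le_r).
have := coprime_partC p e e; rewrite -Dm /coprime gcdnn Dm => /eqP m1.
by rewrite m1 in m_gt1.
Qed.

(* Column orthogonality at x leaves no slack: |chi_i(x)| <= e, while the other
   characters contribute at most e^3 - e^2 to |C_G(x)|. *)
Lemma extremal_isolator x : x \in G -> x != 1%g -> (e ^ 3 <= #|'C_G[x]|)%N ->
  i != 0 -> x \in isolator i.
Proof.
move=> Gx ntx le_e3_C nz_i; have rest := extremal_rest.
have d_gt0 : 0 < (e * e.-1)%:R :> algC by rewrite ltr0n muln_gt0 e_gt0.
pose F j := 'chi[G]_j x * 'chi_j 1%g.
have normF j : `|F j| <= 'chi_j 1%g ^+ 2.
  rewrite normrM (ger0_norm (char1_ge0 (irr_char j))) expr2.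
  by rewrite ler_wpM2r ?char1_ge0 ?irr_char // char1_ge_norm ?irr_char.
have Dde : (e ^ 2 * e.-1 = e * (e * e.-1))%N by rewrite -mulnn mulnA.
have DF : `|\sum_(j | j != i) F j| = `|'chi_i x| * (e * e.-1)%:R.
  by rewrite sum_irr1_mul_neq // normrN normrM Dchi normr_nat.
have chi_le : `|'chi_i x| <= e%:R.
  rewrite -(ler_pM2r d_gt0) -DF -natrM -Dde -rest.
  apply: le_trans (ler_norm_sum _ _ _) _.
  exact: ler_sum.
have sum_le : \sum_(j | j != i) `|'chi_j x| ^+ 2 <= (e ^ 2 * e.-1)%:R.
  rewrite -rest; apply: ler_sum => j _.
  by rewrite lerXn2r ?nnegrE ?normr_ge0 ?char1_ge0 ?char1_ge_norm ?irr_char.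
have DC := second_orthogonality_relation x Gx.
move: DC; rewrite class_refl mulr1n (bigD1 i) //= -normCK.
under eq_bigr => j _ do rewrite -normCK.
move=> DC.
(* Now |chi_i(x)|^2 >= e^3 - e^2 (e-1) = e^2. *)
have chi_e : `|'chi_i x| = e%:R.
  apply/eqP; rewrite eq_le chi_le -(ler_pXn2r (_ : 0 < 2)%N) ?nnegrE ?normr_ge0 ?ler0n //.
  rewrite -(lerD2r (\sum_(j | j != i) `|'chi_j x| ^+ 2)) DC.
  apply: le_trans (lerD (lexx _) sum_le) _.
  rewrite -natrX -natrD ler_nat -mulnS prednK //.
  by rewrite -expnSr.
have sumF : `|\sum_(j | j != i) F j| = \sum_(j | j != i) 'chi_j 1%g ^+ 2.
  by rewrite DF chi_e rest -natrM -Dde.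
have sum_normF : `|\sum_(j | j != i) F j| = \sum_(j | j != i) `|F j|.
  apply/eqP; rewrite eq_le ler_norm_sum sumF /=; exact: ler_sum.
have eq_normF : forall j, j != i -> `|F j| = 'chi_j 1%g ^+ 2.
  apply: (@normC_sum_upper _ _ _ (fun j => `|F j|) (fun j => 'chi_j 1%g ^+ 2)).
    by move=> k _; rewrite normr_id.
  by rewrite -sum_normF.
(* Equality in the triangle inequality gives all [F j] a common phase [t], and [F 0 = 1] shows that
   it is 1. *)
have [t /eqP norm_t Dt] := normC_sum_eq sum_normF.
have t1 : t = 1.
  have nz0 : 0 != i by rewrite eq_sym.
  have F0 : F 0 = 1 by rewrite /F irr0 !cfun1E Gx group1 mulr1.
  by have := Dt 0 nz0; rewrite F0 normr1 mul1r.
apply/isolatorP=> j ij; apply: (mulIf (irr1_neq0 j)).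
by rewrite -/(F j) Dt // t1 mulr1 eq_normF.
Qed.

Lemma extremal_gagola : gagola 'chi_i /\
  (exists N : {group gT},
       [/\ min_normal_sub N G,
           (forall M : {group gT}, min_normal_sub M G -> M = N)
         & #|N| = e]).
Proof.
have nz_i : i != 0.
  apply: contraTneq e_gt1 => i0; move/eqP: Dchi.
  by rewrite i0 irr0 cfun11 eq_sym (eqr_nat _ _ 1) muln_eq1 => /andP[/eqP->].
have nsq : 'chi_i 1%g ^+ 2 != #|G|%:R.
  rewrite -subr_eq0 -oppr_eq0 opprB -sum_irr1_sqr_neq extremal_rest pnatr_eq0.
  by rewrite -lt0n muln_gt0 expn_gt0 e_gt0.
have [p p_pr p_e] := extremal_prime_power; have [P sylP] := Sylow_exists p G.
have le_P : (e ^ 3 <= #|P|)%N.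
  rewrite (card_Hall sylP) -(@part_pnat_id p (e ^ 3)%N) ?pnatX ?p_e //.
  by rewrite dvdn_leq ?part_gt0 // partn_dvd ?cardG_gt0 // DG dvdn_mulr.
have ntZ : 'Z(P) != 1%g.
  rewrite center_nil_eq1 ?(pgroup_nil (pHall_pgroup sylP)) // -cardG_gt1.
  by apply: leq_trans le_P; rewrite -(exp1n 3) ltn_exp2r.
have [x /setIP[Px cPx] ntx] := trivgPn _ ntZ.
have Gx : x \in G := subsetP (pHall_sub sylP) x Px.
have Nx : x \in isolator i.
  apply: extremal_isolator => //; apply: leq_trans le_P _; apply: subset_leq_card.
  by rewrite subsetI (pHall_sub sylP) sub_cent1.
have ntN : isolator i :!=: 1%g by apply/trivgPn; exists x.
split; first exact: isolator_gagola.
exists (isolator i); split; first exact: isolator_minnormal.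
  by move=> M; apply: isolator_minnormal_unique.
have d_gt0 : (0 < e * e.-1)%N by rewrite muln_gt0 e_gt0.
have Dx : 'chi_i x = - e%:R.
  apply: (mulIf (irr1_neq0 i)); rewrite isolator_val //.
  rewrite -opprB -sum_irr1_sqr_neq extremal_rest Dchi mulNr -natrM.
  by rewrite -mulnn mulnA.
(* The column of x gives e^2 + e^2 (e-1) = e^3, so the class N^# has e-1 elements. *)
have DC : #|'C_G[x]| = (e ^ 3)%N.
  apply/eqP; rewrite -(eqr_nat algC).
  have := second_orthogonality_relation x Gx; rewrite class_refl mulr1n => <-.
  rewrite (bigD1 i) //= (eq_bigr (fun j => 'chi_j 1%g ^+ 2)) => [|j ij].
    by rewrite extremal_rest Dx -normCK normrN normr_nat -natrX -natrD -mulnS prednK -?expnSr.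
  by rewrite (isolatorP Nx) // irr1_conj expr2.
have := Lagrange (subsetIl G 'C[x]).
rewrite index_cent1 DC DG => /eqP; rewrite eqn_pmul2l ?expn_gt0 ?e_gt0 //.
rewrite (isolator_class nz_i) // => /eqP DN.
by rewrite (cardsD1 1%g) group1 DN add1n prednK.
Qed.

End Extremal.
(* Orthogonality of a Gagola character to the principal one and to chi_l gives
   chi_l(x) = chi_l(1) on the nontrivial class where it does not vanish. *)
Lemma gagola_isolator (i : Iirr G) :
  i != 0 -> gagola 'chi_i -> isolator i :!=: 1%g.
Proof.
move=> nz_i [_]; set S := [set xG in classes G | _] => S2.
have S1 : 1%g ^: G \in S.
  rewrite inE mem_classes //; apply/exists_inP; exists 1%g.
    exact: class_refl.
  exact: irr1_neq0.
have [xG DS] : exists xG, S :\ (1%g ^: G) = [set xG].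
  by apply/cards1P; move: S2; rewrite (cardsD1 (1%g ^: G)) S1 add1n => -[->].
have : xG \in S :\ (1%g ^: G) by rewrite DS set11.
rewrite !inE => /and3P[nt_xG /imsetP[x Gx DxG] _].
have ntx : x != 1%g by apply: contraNneq nt_xG => x1; rewrite DxG x1.
have van y : y \in G -> y != 1%g -> y \notin xG -> 'chi_i y = 0.
  move=> Gy nty xG'y; apply/eqP/contraT=> nz_y.
  have : y ^: G \in S :\ (1%g ^: G).
    rewrite !inE mem_classes //=; apply/andP; split.
      apply: contra nty => /eqP DyG; have := class_refl G y.
      by rewrite DyG class1G inE.
    by apply/exists_inP; exists y; rewrite ?class_refl.
  rewrite DS inE => /eqP DyG; case/negP: xG'y.
  by rewrite -DyG class_refl.
have dot l : l != i ->
  'chi_l 1%g * 'chi_i 1%g = - ('chi_l x * (#|xG|%:R * ('chi_i x)^*)).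
  move=> li; have := cfdot_irr l i; rewrite (negPf li) cfdotE => /eqP.
  rewrite mulf_eq0 invr_eq0 (negPf (neq0CG G)) /= (bigD1 1%g) //= irr1_conj.
  rewrite addr_eq0 => /eqP->; congr (- _).
  rewrite (bigID (mem xG)) /= [X in _ + X]big1 => [|y /andP[/andP[Gy nty] xG'y]]; last first.
    by rewrite van // conjC0 mulr0.
  rewrite addr0 (eq_big (mem xG) (fun=> 'chi_l x * ('chi_i x)^*)) => [|y|y].
  - by rewrite sumr_const -[LHS]mulr_natl mulrCA.
  - apply: andb_idl; rewrite DxG => /imsetP[z Gz ->].
    by rewrite groupJ ?conjg_eq1.
  by case/andP=> _; rewrite DxG => /imsetP[z Gz ->]; rewrite !cfunJ.
apply/trivgPn; exists x => //; apply/isolatorP=> l li.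
have nz0 : 0 != i by rewrite eq_sym.
have := dot l li; rewrite -mulrN.
(* The trivial character identifies the factor multiplying chi_l(x) as chi_i(1), which cancels. *)
have := dot 0 nz0; rewrite irr0 !cfun1E Gx group1 !mul1r => <-.
by move/(mulIf (irr1_neq0 i)).
Qed.

Lemma gagola_card (i : Iirr G) (d e : nat) (N : {group gT}) :
    (1 < d)%N -> (1 < e)%N -> #|G| = (d * (d + e))%N -> 'chi_i 1%g = d%:R ->
    gagola 'chi_i -> (forall M : {group gT}, min_normal_sub M G -> M = N) ->
  #|N| = e -> #|G| = (e ^ 4 - e ^ 3)%N.
Proof.
move=> d_gt1 e_gt1 DG Dd gag uniqN cardN.
have nz_i : i != 0.
  apply: contraTneq d_gt1 => i0; move/eqP: Dd.
  by rewrite i0 irr0 cfun11 eq_sym (eqr_nat _ _ 1) => /eqP->.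
have rest : \sum_(j | j != i) 'chi_j 1%g ^+ 2 = (d * e)%:R :> algC.
  rewrite sum_irr1_sqr_neq DG Dd mulnDr natrD -natrX addrAC -mulnn subrr.
  by rewrite add0r.
have d_gt0 := ltnW d_gt1; have e_gt0 := ltnW e_gt1.
have nsq : 'chi_i 1%g ^+ 2 != #|G|%:R.
  rewrite -subr_eq0 -oppr_eq0 opprB -sum_irr1_sqr_neq rest pnatr_eq0.
  by rewrite -lt0n muln_gt0 d_gt0.
have ntN := gagola_isolator nz_i gag.
(* The isolator is itself minimal normal, so uniqueness identifies it with N. *)
have DN : isolator i = N by apply/uniqN/isolator_minnormal.
have [x Nx ntx] := trivgPn _ ntN.
have Gx : x \in G := subsetP (normal_sub (isolator_normal nz_i)) x Nx.
have Dx : 'chi_i x = - e%:R.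
  apply: (mulIf (irr1_neq0 i)); rewrite isolator_val //.
  by rewrite -opprB -sum_irr1_sqr_neq rest Dd mulNr -natrM mulnC.
have DC : #|'C_G[x]| = (e * (d + e))%N.
  apply/eqP; rewrite -(eqr_nat algC).
  have := second_orthogonality_relation x Gx; rewrite class_refl mulr1n => <-.
  rewrite (bigD1 i) //= (eq_bigr (fun j => 'chi_j 1%g ^+ 2)) => [|j ij].
    by rewrite rest Dx -normCK normrN normr_nat -natrX -natrD addnC mulnDr mulnC mulnn.
  by rewrite (isolatorP Nx) // irr1_conj expr2.
have := Lagrange (subsetIl G 'C[x]).
rewrite index_cent1 DC DG (isolator_class nz_i) //.
have -> : #|(isolator i)^#| = e.-1.
  by move: cardN; rewrite -DN (cardsD1 1%g) group1 => <-.
(* Cancelling d + e from e (e-1) (d+e) = d (d+e) leaves d = e (e-1). *)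
rewrite mulnAC => /eqP; rewrite eqn_pmul2r ?addn_gt0 ?d_gt0 // => /eqP Dde.
rewrite -Dde; case: (e) e_gt0 => // k _ /=.
rewrite expnS -{2}[(_ ^ 3)%N]mul1n -mulnBl subn1 /=; ring.
Qed.

End LargeDegree.

Theorem theorem7p2 (gT : finGroupType) (G : {group gT}) (i : Iirr G) (d e : nat) :
  'chi_i 1%g = d%:R -> (1 < d)%N -> (1 < e)%N -> #|G| = (d * (d + e))%N ->
  (#|G| = (e ^ 4 - e ^ 3)%N <->
   ((exists j : Iirr G, gagola 'chi_j /\ 'chi_j 1%g = d%:R) /\
    (exists N : {group gT},
       [/\ min_normal_sub N G,
           (forall M : {group gT}, min_normal_sub M G -> M = N)
         & #|N| = e]))).
Proof.
move=> Dd d_gt1 e_gt1 DG; split=> [DG4 | [[j [gag Dj]] [N [_ uniqN cardN]]]].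
  have DG3 : #|G| = (e ^ 3 * e.-1)%N.
    by rewrite DG4 expnSr -{2}[(e ^ 3)%N]muln1 -mulnBr subn1.
  (* d (d+e) increases with d and takes the value e^3 (e-1) at d = e (e-1). *)
  have Dde : d = (e * e.-1)%N.
    move: DG3 d_gt1; rewrite DG; case: (e) e_gt1 => // k _ /= Dk d_gt1.
    nia.
  rewrite Dde in Dd; have [gag [N PN]] := extremal_gagola e_gt1 Dd DG3.
  by split; [exists i; rewrite Dde | exists N].
(* The Gagola character chi_j, not the given chi_i, is used here; both have degree d. *)
exact: gagola_card DG Dj gag uniqN cardN.
Qed.
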